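(* Let $V$ be the Lévy process of log-prices, $\psi_V(q):=\ln\mathbb{E}[e^{-qV_1}]$ its Laplace exponent, $T_1>0$ a.s. a random time independent of $V$, and $H(q):=\ln\mathbb{E}[e^{-qV_{T_1}}]$. Then for $\beta>0$ one has $\mathbb{E}[e^{-\beta V_{T_1}}]=\mathbb{E}[e^{T_1\psi_V(\beta)}]$ and $$H(\beta)=0\iff\mathbb{E}[e^{T_1\psi_V(\beta)}]=1\iff\psi_V(\beta)=0.$$ In particular, if $H$ has a unique root $\beta>0$, lying strictly inside $\mathrm{int}(\mathrm{dom}\,H)$, then $\psi_V(\beta)=0$.
   Context: $V=(V_t)_{t\ge0}$ is a real-valued Lévy process (the logarithm of the risky-asset price $\mathcal{E}(R)=e^V$, where $R$ is a Lévy process with jumps greater than $-1$). $T_1$ is the first jump time of a renewal process independent of $V$, with law $F$ on $[0,\infty)$ satisfying $F(\{0\})=0$. Exponents may take the value $+\infty$, with the convention $e^{+\infty}=+\infty$; $\mathrm{dom}\,H:=\{q\in\mathbb{R}:H(q)<\infty\}$. *)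

(* Defs.v *)
From HB Require Import structures.
From mathcomp Require Import all_boot all_order all_algebra.
From mathcomp Require Import all_classical all_reals all_analysis.

Set Implicit Arguments.
Unset Strict Implicit.
Unset Printing Implicit Defensive.

Import Order.TTheory GRing.Theory Num.Theory.
Import numFieldNormedType.Exports.

Local Open Scope classical_set_scope.
Local Open Scope ring_scope.

Section Processes.
Context (R : realType) (d : measure_display) (T : measurableType d)
  (P : probability T R).
Implicit Types (V : R -> {RV P >-> R}) (X : T -> R).

Definition independent_systems (F G : set (set T)) : Prop :=
  forall A B, F A -> G B -> P (A `&` B) = (P A * P B)%E.

Definition sigma_process V (I : set R) : set (set T) :=
  <<s \bigcup_(t in I) g_sigma_algebra_preimage (V t) >>.

(* Time is [0, +oo[: the random variables V t with t < 0 are unconstrained and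
   are never used.  Equality in law is only required on measurable sets, since
   a measure is unspecified on the other sets. *)
Record levy_process V : Prop := LevyProcess {
  levy_start : {ae P, forall w, V 0 w = 0} ;
  levy_independent_increments : forall s t : R, 0 <= s -> s <= t ->
    independent_systems (sigma_process V `[0, s])
                        (g_sigma_algebra_preimage (V t \- V s)) ;
  levy_stationary_increments : forall s t : R, 0 <= s -> s <= t ->
    forall A : set R, measurable A ->
      P ((V t \- V s) @^-1` A) = P (V (t - s) @^-1` A) ;
  levy_cadlag : {ae P, forall w,
    (forall t : R, 0 <= t -> V s w @[s --> t^'+] --> V t w) /\
    (forall t : R, 0 < t -> cvg (V s w @[s --> t^'-]))} }.

Definition independent_of_process V X : Prop :=
  independent_systems (g_sigma_algebra_preimage X) (sigma_process V `[0, +oo[).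

Definition process_at V X : T -> R := fun w => V (X w) w.

(* ln E[e^(-q X)] as an extended real: it is +oo when the expectation is. *)
Definition laplace_exponent X (q : R) : \bar R :=
  lne 'E_P[fun w => expR (- q * X w)].

End Processes.

Definition dom (R : realType) (H : R -> \bar R) : set R :=
  [set q | (H q < +oo)%E].

(* Main.v *)
Require Import Defs.
From HB Require Import structures.
From mathcomp Require Import all_boot all_order all_algebra.
From mathcomp Require Import all_classical all_reals all_analysis.
From mathcomp Require Import measurable_realfun lra.
Import Order.TTheory GRing.Theory Num.Theory.
Import numFieldNormedType.Exports.
Local Open Scope classical_set_scope.
Local Open Scope ring_scope.

(** Write phi(t) = E[e^(-beta V_t)].  The proof has two halves, joined by the
identity E[e^(-beta V_T)] = E[phi(T)] = E[e^(T psi(beta))], T being the random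
time.

Stationary independent increments make phi multiplicative
(marginal_mean_expD), and right-continuity of the paths makes it lower
semicontinuous from the right.  A positive multiplicative function with that
much regularity is t |-> phi(1)^t (multiplicative_exp), also when phi(1) = +oo,
and phi(1)^t = e^(t psi(beta)).

The first equality is conditioning on T. The map (t, w) |-> V_t w is not known
to be jointly measurable, so T is approximated from the right by the grid-
valued times up_grid n T. For these, conditioning is a countable sum over the
cells of the grid in which only the independence of T and a single V_t occurs
(integral_grid). Right-continuity carries the identity to T itself for bounded
continuous functions (integral_at_time_bounded), and monotone convergence
extends it to the exponential (integral_at_time), with infinite values
allowed.

Finally T > 0 almost surely, so e^(T psi(beta)) is almost surely on the same
strict side of 1 as psi(beta) is of 0, and a strict pointwise inequality is kept
by the integral (integral_lt).  Hence E[e^(T psi(beta))] = 1 exactly when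
psi(beta) = 0. *)

(** * Approximating a time from the right *)

(** The least multiple of 1 / (n + 1) that is strictly greater than t, for
t >= 0.  Being strictly greater makes its limit a limit from the right, the
side on which a cadlag path is continuous. *)
Definition up_grid {R : realType} (n : nat) (t : R) : R :=
  (Num.truncn (n.+1%:R * t)).+1%:R / n.+1%:R.

Lemma up_grid_gt {R : realType} (n : nat) (t : R) : t < up_grid n t.
Proof. by rewrite /up_grid ltr_pdivlMr// mulrC; exact: truncnS_gt. Qed.

Lemma cvg_up_grid {R : realType} (t : R) : 0 <= t ->
  up_grid n t @[n --> \oo] --> t.
Proof.
move=> t0.
have le n : up_grid n t <= t + n.+1%:R^-1.
  rewrite /up_grid ler_pdivrMr// mulrDl mulVf// -natr1 lerD2r mulrC.
  by have /andP[] := truncn_itv (mulr_ge0 t0 (ler0n R n.+1)); rewrite mulrC.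
apply: (@squeeze_cvgr _ _ _ _ (fun=> t) (fun n => t + n.+1%:R^-1)).
- by apply: nearW => n; rewrite ltW ?up_grid_gt//=.
- exact: cvg_cst.
- rewrite -[X in _ --> X]addr0; apply: cvgD; first exact: cvg_cst.
  exact: cvg_harmonic.
Qed.

Lemma cvg_right_up_grid {R : realType} (f : R -> R) (t l : R) : 0 <= t ->
  f s @[s --> t^'+] --> l -> f (up_grid n t) @[n --> \oo] --> l.
Proof.
move=> t0 /cvg_at_rightP; apply; split; last exact: cvg_up_grid.
by move=> n; exact: up_grid_gt.
Qed.

(** * Integration of nonnegative functions *)

Section integration.
Import HBNNSimple.
Context {R : realType} {d : measure_display} {T : measurableType d}.
Variable P : probability T R.
Local Open Scope ereal_scope.

(** The joint law of X and Y is the product of their laws, because the two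
measures agree on rectangles; Tonelli then separates the variables. *)
Lemma ge0_integral_indep (X Y : {mfun T >-> R}) (f g : R -> \bar R) :
  (forall A B : set R, measurable A -> measurable B ->
    P (X @^-1` A `&` Y @^-1` B) = P (X @^-1` A) * P (Y @^-1` B)) ->
  measurable_fun setT f -> measurable_fun setT g ->
  (forall x, 0 <= f x) -> (forall x, 0 <= g x) ->
  \int[P]_w (f (X w) * g (Y w)) = \int[P]_w f (X w) * \int[P]_w g (Y w).
Proof.
move=> XY mf mg f0 g0.
have mXY : measurable_fun setT (fun w => (X w, Y w)).
  exact: measurable_fun_pair.
pose mu := pushforward P (fun w => (X w, Y w)).
pose mX := distribution P X; pose mY := distribution P Y.
pose F (z : R * R) := f z.1 * g z.2.
have mF : measurable_fun setT F.
  apply: emeasurable_funM; first exact: measurableT_comp.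
  exact: measurableT_comp.
have F0 z : 0 <= F z by exact: mule_ge0.
transitivity (\int[mu]_z F z).
  by rewrite ge0_integral_pushforward.
transitivity (\int[mX \x mY]_z F z).
  apply/esym/eq_measure_integral => A mA _.
  apply: product_measure_unique => // B C mB mC.
rewrite fubini_tonelli1//.
rewrite (_ : \int[P]_w f (X w) = \int[mX]_x f x); last first.
  by rewrite ge0_integral_distribution.
rewrite (_ : \int[P]_w g (Y w) = \int[mY]_y g y); last first.
  by rewrite ge0_integral_distribution.
transitivity (\int[mX]_x (f x * \int[mY]_y g y)).
  apply: eq_integral => x _; rewrite /fubini_F /F/=.
  by rewrite ge0_integralZl.
by rewrite ge0_integralZr// integral_ge0.
Qed.

(** For the process sampled at a random time, which need not be measurable
because its paths are regular only off a null set.  The integral of a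
nonnegative function is in any case a supremum over the simple functions below
it, and each of them may be cut off on N without changing its integral. *)
Lemma integral_ge0_null (mu : {measure set T -> \bar R}) (N : set T)
    (f : T -> \bar R) :
  measurable N -> mu N = 0 -> (forall w, 0 <= f w) ->
  \int[mu]_w f w = \int[mu]_(w in ~` N) f w.
Proof.
move=> mN N0 f0; rewrite [RHS]integral_mkcond; apply/eqP; rewrite eq_le.
have f'0 w : 0 <= (f \_ (~` N)) w by rewrite patchE; case: ifPn.
apply/andP; split; rewrite !ge0_integralTE//; last first.
  apply: ereal_sup_le => _ [h hf <-]; exists h => // w.
  by rewrite (le_trans (hf w))// patchE; case: ifPn.
apply: ge_ereal_sup => _ [h hf <-].
rewrite -(patch_setT (fun=> 0%R) h) -integral_nnsfun//.
rewrite (ge0_negligible_integral mN)//; last 2 first.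
- exact/measurable_EFinP.
- by move=> w _; rewrite lee_fin fun_ge0.
have mNC : measurable (~` N) by exact: measurableC.
rewrite setTD integral_nnsfun// (mrestrict _ mNC).
apply: ereal_sup_ubound; exists (proj_nnsfun h mNC) => // w.
rewrite -mrestrict !patchE; case: ifPn => // _; exact: hf.
Qed.

Lemma cvg_integral_nondecreasing (mu : {measure set T -> \bar R}) (D : set T)
    (f_ : (T -> \bar R)^nat)
    (f : T -> \bar R) : measurable D ->
  (forall n, measurable_fun D (f_ n)) ->
  (forall n w, D w -> 0 <= f_ n w) ->
  (forall w, D w -> nondecreasing_seq (f_ ^~ w)) ->
  (forall w, D w -> f_ n w @[n --> \oo] --> f w) ->
  \int[mu]_(w in D) f_ n w @[n --> \oo] --> \int[mu]_(w in D) f w.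
Proof.
move=> mD mf_ f_0 f_nd f_f.
rewrite (eq_integral (fun w => limn (f_ ^~ w))); last first.
  by move=> w /[!inE] Dw; apply/esym/cvg_lim => //; exact: f_f.
exact: cvg_monotone_convergence.
Qed.

End integration.

(** * Multiplicative functions of time *)

Section exponential.
Context {R : realType}.
Variable phi : R -> \bar R.
Local Open Scope ereal_scope.
Hypothesis phiD : forall s t : R, (0 <= s)%R -> (0 <= t)%R ->
  phi (s + t)%R = phi s * phi t.
Hypothesis phi_gt0 : forall t : R, (0 <= t)%R -> 0 < phi t.
(* Lower semicontinuity from the right, tested on the grid times only. *)
Hypothesis phi_lsc : forall (t c : R) (u : R^nat), (0 <= t)%R ->
  (forall n, phi (up_grid n t) <= (u n)%:E) -> u @ \oo --> c ->
  phi t <= c%:E.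

Lemma multiplicative_finS (t : R) n : (0 <= t)%R -> phi t < +oo ->
  phi (n.+1%:R * t)%R < +oo.
Proof.
move=> t0 tf; elim: n => [|n IH]; first by rewrite mul1r.
rewrite -natr1 mulrDl mul1r phiD ?mulr_ge0//.
by rewrite lte_mul_pinfty ?ltW ?phi_gt0 ?mulr_ge0// ge0_fin_numE ?ltW ?phi_gt0
  ?mulr_ge0.
Qed.

Lemma multiplicative_fin (s t : R) : (0 <= s)%R -> (s <= t)%R ->
  phi t < +oo -> phi s < +oo.
Proof.
move=> s0 st; rewrite -(subrK s t) phiD// ?subr_ge0//.
apply: contraTT; rewrite -!leNgt !leye_eq => /eqP ->.
by rewrite gt0_muley// phi_gt0// subr_ge0.
Qed.

Lemma multiplicative_fin1 (s t : R) : (0 < s)%R -> (0 <= t)%R ->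
  phi s < +oo -> phi t < +oo.
Proof.
move=> s0 t0 /(multiplicative_finS _ (Num.truncn (t / s)) (ltW s0)).
apply: multiplicative_fin => //.
by rewrite -ler_pdivrMr//; exact/ltW/truncnS_gt.
Qed.

(** Let l = ln phi, an additive function.  It is linear on rational times, and
semicontinuity along the grid, which decreases to s, gives l s <= s * l 1 for
every s >= 0.  Applied to both t and N - t with N an integer above t, the two
inequalities sum up to the equality l N = N * l 1, hence both are equalities. *)
Lemma multiplicative_fin_exp (t : R) : phi 1 < +oo -> (0 <= t)%R ->
  phi t = (expR (t * ln (fine (phi 1))))%:E.
Proof.
move=> fin1.
have fin (s : R) : (0 <= s)%R -> phi s \is a fin_num.
  move=> s0; rewrite ge0_fin_numE ?ltW ?phi_gt0//.
  exact: (multiplicative_fin1 _ _ ltr01).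
pose l s := ln (fine (phi s)).
have phiE (s : R) : (0 <= s)%R -> phi s = (expR (l s))%:E.
  move=> s0; rewrite /l lnK ?fineK ?fin// posrE fine_gt0// phi_gt0//=.
  by rewrite -ge0_fin_numE ?fin// ltW// phi_gt0.
have lD (s u : R) : (0 <= s)%R -> (0 <= u)%R -> (l (s + u) = l s + l u)%R.
  move=> s0 u0; apply: expR_inj; apply: EFin_inj.
  by rewrite expRD EFinM -!phiE ?phiD ?addr_ge0.
have l0 : l 0%R = 0%R.
  by have := lD 0%R 0%R (lexx _) (lexx _); rewrite addr0; lra.
have lM n (s : R) : (0 <= s)%R -> (l (n%:R * s) = n%:R * l s)%R.
  move=> s0; elim: n => [|n IH]; first by rewrite !mul0r.
  by rewrite -natr1 !mulrDl !mul1r lD ?mulr_ge0// IH.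
have lN n : (l n%:R = n%:R * l 1)%R by rewrite -{1}[n%:R]mulr1 lM.
have lg n (s : R) : (l (up_grid n s) = up_grid n s * l 1)%R.
  apply: (@mulfI _ n.+1%:R) => //; rewrite -lM ?divr_ge0//.
  by rewrite [RHS]mulrA [(n.+1%:R * _)%R]mulrC divfK// lN.
have le (s : R) : (0 <= s)%R -> (l s <= s * l 1)%R.
  move=> s0; rewrite -ler_expR -lee_fin -phiE//.
  apply: (phi_lsc _ _ (fun n => expR (up_grid n s * l 1)%R)) => //.
    by move=> n; rewrite -lg phiE// divr_ge0.
  apply: continuous_cvg; first exact: continuous_expR.
  by apply: cvgMl; exact: cvg_up_grid.
move=> t0; rewrite phiE//; congr (expR _)%:E.
apply/eqP; rewrite eq_le le//=.
pose N := (Num.truncn t).+1.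
have tN : (0 <= N%:R - t)%R by rewrite subr_ge0 ltW// truncnS_gt.
have := le _ tN; have := lD _ _ tN t0; rewrite subrK lN mulrBl -/(l 1%R).
lra.
Qed.

(** When phi 1 = +oo both sides are +oo, because finiteness at one positive time
spreads to all times.  At t = 0 the right-hand side is 1 by the convention
0 * +oo = 0, while phi may be +oo everywhere; hence t > 0. *)
Lemma multiplicative_exp (t : R) : (0 < t)%R ->
  phi t = expeR (t%:E * lne (phi 1)).
Proof.
move=> t0; have [fin1|] := ltP (phi 1%R) +oo.
  rewrite multiplicative_fin_exp ?ltW//.
  have fin : phi 1%R \is a fin_num by rewrite ge0_fin_numE// ltW// phi_gt0.
  rewrite -{2}(fineK fin) lne_EFin//.
  by rewrite fine_gt0// fin1 phi_gt0.
rewrite leye_eq => /eqP phi1; rewrite phi1/= gt0_muley ?lte_fin//=.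
apply/eqP; rewrite -leye_eq leNgt; apply/negP => tf.
by have := multiplicative_fin1 t 1 t0 ler01 tf; rewrite phi1.
Qed.

End exponential.

(** * Strict inequalities between integrals *)

Lemma integral_gt0 {R : realType} {d : measure_display} {T : measurableType d}
    (mu : {measure set T -> \bar R}) (D : set T) (f : T -> \bar R) :
  measurable D -> (mu D != 0)%E -> measurable_fun D f ->
  (forall x, D x -> (0 < f x)%E) -> (0 < \int[mu]_(x in D) f x)%E.
Proof.
move=> mD D0 mf f0; rewrite lt0e integral_ge0 => [|x /f0/ltW//]; rewrite andbT.
apply: contra D0 => /eqP If0; apply/eqP/measure_negligible => //.
have /(ae_eq_integral_abs mu mD mf) : (\int[mu]_(x in D) `|f x| = 0)%E.
  by rewrite -[RHS]If0; apply: eq_integral => x /[!inE] /f0/ltW/gee0_abs.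
apply: negligibleS => x Dx /= /(_ Dx) fx0.
by have := f0 _ Dx; rewrite fx0 ltxx.
Qed.

Lemma integral_lt {R : realType} {d : measure_display} {T : measurableType d}
    (mu : {measure set T -> \bar R}) (D : set T) (f g : T -> \bar R) :
  measurable D -> (mu D != 0)%E ->
  measurable_fun D f -> measurable_fun D g ->
  (forall x, D x -> (0 <= f x)%E) -> (forall x, D x -> (f x < g x)%E) ->
  (\int[mu]_(x in D) f x < +oo)%E ->
  (\int[mu]_(x in D) f x < \int[mu]_(x in D) g x)%E.
Proof.
move=> mD D0 mf mg f0 fg ifin.
have ffin x : D x -> f x \is a fin_num.
  by move=> Dx; rewrite ge0_fin_numE ?f0// (lt_le_trans (fg _ Dx))// leey.
have mgf : measurable_fun D (fun x => g x - f x)%E by exact: emeasurable_funB.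
have gf0 x : D x -> (0 < g x - f x)%E.
  by move=> Dx; rewrite sube_gt0 fg.
have -> : (\int[mu]_(x in D) g x =
    \int[mu]_(x in D) f x + \int[mu]_(x in D) (g x - f x))%E.
  rewrite -ge0_integralD//; last by move=> x /gf0/ltW.
  by apply: eq_integral => x /[!inE] Dx; rewrite addeC subeK// ffin.
rewrite lteDl ?integral_gt0//.
by rewrite ge0_fin_numE// integral_ge0.
Qed.


Lemma continuous_min_natr {R : realType} (h : R -> R) (n : nat) :
  continuous h -> continuous (fun x => Num.min (h x) n%:R).
Proof.
move=> ch x; apply: (@continuous_min R R h (fun=> n%:R) x); first exact: ch.
exact: cvg_cst.
Qed.

(** * One-dimensional marginals of a Levy process *)

Section marginals.
Context {R : realType} {d : measure_display} {T : measurableType d}.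
Variables (P : probability T R) (V : R -> {RV P >-> R}).

Definition marginal_mean (h : R -> R) (t : R) : \bar R :=
  (\int[P]_w (h (V t w))%:E)%E.

Lemma marginal_mean_ge0 (h : R -> R) (t : R) : (forall x, 0 <= h x) ->
  (0 <= marginal_mean h t)%E.
Proof. by move=> h0; apply: integral_ge0 => w _; rewrite lee_fin. Qed.

Lemma marginal_mean_le (h : R -> R) (t M : R) : measurable_fun setT h ->
  (forall x, 0 <= h x <= M) -> (marginal_mean h t <= M%:E)%E.
Proof.
move=> mh hM.
apply: (@le_trans _ _ (\int[P]_w (cst M%:E) w)%E).
  apply: ge0_le_integral => //.
  - by move=> w _; rewrite lee_fin; case/andP: (hM (V t w)).
  - by apply/measurable_EFinP; exact: measurableT_comp.
  - by move=> w _; rewrite lee_fin; case/andP: (hM (V t w)).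
by rewrite integral_cst//= probability_setT mule1.
Qed.

Lemma cvg_min_natr (x : R) : (Num.min x n%:R)%:E @[n --> \oo] --> x%:E.
Proof.
apply: cvg_near_cst; exists (Num.truncn x).+1 => // n /= xn.
by rewrite min_l// ltW// (lt_le_trans (truncnS_gt _))// ler_nat.
Qed.

Lemma cvg_marginal_mean_min (h : R -> R) (t : R) : measurable_fun setT h ->
  (forall x, 0 <= h x) ->
  marginal_mean (fun x => Num.min (h x) n%:R) t @[n --> \oo]
    --> marginal_mean h t.
Proof.
move=> mh h0; apply: cvg_integral_nondecreasing => //.
- move=> n; apply/measurable_EFinP/measurable_minr => //.
  exact: measurableT_comp.
- by move=> n w _; rewrite lee_fin le_min h0/=.
- by move=> w _ m n mn; rewrite lee_fin le_min2// ler_nat.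
- by move=> w _; exact: cvg_min_natr.
Qed.

Hypothesis hV : levy_process V.

Lemma marginal_mean_right_cvg (h : R -> R) (t M : R) : 0 <= t ->
  continuous h -> (forall x, 0 <= h x <= M) ->
  marginal_mean h (up_grid n t) @[n --> \oo] --> marginal_mean h t.
Proof.
move=> t0 ch hM.
have mh : measurable_fun setT h by exact: continuous_measurable_fun.
have mhV s : measurable_fun setT (fun w => (h (V s w))%:E).
  by apply/measurable_EFinP; exact: measurableT_comp.
have [] := @dominated_convergence _ _ _ P setT measurableT
  (fun n w => (h (V (up_grid n t) w))%:E) (fun w => (h (V t w))%:E)
  (cst M%:E).
- by move=> n; exact: mhV.
- exact: mhV.
- apply: filterS (levy_cadlag hV) => w [rc _] _ /=.
  have hcvg : h (V (up_grid n t) w) @[n --> \oo] --> h (V t w).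
    apply: (@continuous_cvg _ _ _ _ _ (fun n => V (up_grid n t) w) h).
      exact: ch.
    by apply: (cvg_right_up_grid (fun s => V s w)) => //; exact: rc.
  by apply: cvg_EFin hcvg; exact: nearW.
- exact: finite_measure_integrable_cst.
- apply: aeW => w n _; rewrite /= lee_fin ger0_norm; last first.
    by case/andP: (hM (V (up_grid n t) w)).
  by case/andP: (hM (V (up_grid n t) w)).
by [].
Qed.

(** The increment over [s, s + t] is independent of V s and distributed as
V t. *)
Lemma marginal_mean_expD (b s t : R) : 0 <= s -> 0 <= t ->
  marginal_mean (fun x => expR (b * x)) (s + t) =
  (marginal_mean (fun x => expR (b * x)) s *
   marginal_mean (fun x => expR (b * x)) t)%E.
Proof.
move=> s0 t0.
have sst : s <= s + t by rewrite lerDl.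
pose g x : \bar R := (expR (b * x))%:E.
have mg : measurable_fun setT g.
  apply/measurable_EFinP/measurableT_comp; first exact: measurable_expR.
  exact: measurable_funM.
have g0 x : (0 <= g x)%E by rewrite lee_fin expR_ge0.
have mY : measurable_fun setT (V (s + t) \- V s) by exact: measurable_funB.
pose Y : {mfun T >-> R} := mfun_Sub (mem_set mY).
transitivity (\int[P]_w (g (V s w) * g (Y w)))%E.
  apply: eq_integral => w _; rewrite /g -EFinM -expRD -mulrDr.
  by congr (expR (b * _))%:E; rewrite /Y/= [RHS]addrC subrK.
rewrite ge0_integral_indep//.
  congr (_ * _)%E.
  transitivity (\int[distribution P Y]_y g y)%E.
    by rewrite ge0_integral_distribution.
  transitivity (\int[distribution P (V t)]_y g y)%E; last first.
    by rewrite ge0_integral_distribution.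
  apply: eq_measure_integral => A mA _.
  have := levy_stationary_increments hV s0 sst mA.
  by rewrite addrAC subrr add0r.
move=> A B mA mB; apply: (levy_independent_increments hV s0 sst).
  apply: sub_sigma_algebra; exists s => /=; first by rewrite in_itv/= s0 lexx.
  by exists A => //; rewrite setTI.
by exists B => //; rewrite setTI.
Qed.

Lemma marginal_mean_exp_gt0 (b t : R) :
  (0 < marginal_mean (fun x => expR (b * x)) t)%E.
Proof.
apply: integral_gt0 => //.
- by rewrite [X in X != _](_ : _ = 1%E) ?onee_neq0//; exact: probability_setT.
- apply/measurable_EFinP/measurableT_comp; first exact: measurable_expR.
  exact: measurable_funM.
- by move=> x _; rewrite lte_fin expR_gt0.
Qed.

(** The exponential is unbounded, so right-continuity of the paths does not give
right-continuity of its mean directly; truncating it at m, passing to the limit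
along the grid and then letting m grow gives the semicontinuity that
multiplicative_exp asks for. *)
Lemma marginal_mean_exp (b t : R) : 0 < t ->
  marginal_mean (fun x => expR (b * x)) t =
  expeR (t%:E * lne (marginal_mean (fun x => expR (b * x)) 1)).
Proof.
move=> t0.
apply: (multiplicative_exp (marginal_mean (fun x => expR (b * x)))) => //.
- exact: marginal_mean_expD.
- by move=> *; exact: marginal_mean_exp_gt0.
move=> {t0}t c u t0 uM uc.
have mh : measurable_fun setT (fun x => expR (b * x)).
  apply: measurableT_comp; first exact: measurable_expR.
  exact: measurable_funM.
have h0 x : 0 <= expR (b * x) by exact: expR_ge0.
have cmin m : continuous (fun x : R => Num.min (expR (b * x)) m%:R).
  apply: continuous_min_natr => x.
  apply: continuous_comp; last exact: continuous_expR.
  by apply: cvgMr; exact: cvg_id.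
apply: cvge_le (cvg_marginal_mean_min _ t mh h0); apply: nearW => m.
have cvgm : marginal_mean (fun x => Num.min (expR (b * x)) m%:R)
    (up_grid n t) @[n --> \oo] -->
    marginal_mean (fun x => Num.min (expR (b * x)) m%:R) t.
  apply: (marginal_mean_right_cvg _ _ m%:R) => // x.
  by rewrite le_min h0 ler0n ge_min lexx orbT.
have cvgu : (u n)%:E @[n --> \oo] --> c%:E.
  by apply: cvg_EFin uc; exact: nearW.
apply: (lee_cvg_to cvgm cvgu); apply: nearW => n; apply: le_trans (uM n).
have mV : measurable_fun setT (fun w => expR (b * V (up_grid n t) w)).
  exact: (measurableT_comp mh).
apply: ge0_le_integral => //.
- by apply/measurable_EFinP/measurable_minr.
- exact/measurable_EFinP.
- by move=> w _; rewrite lee_fin ge_min lexx.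
Qed.

End marginals.

(** * An independent random time with values on a grid *)

Section random_time.
Context {R : realType} {d : measure_display} {T : measurableType d}.
Variables (P : probability T R) (V : R -> {RV P >-> R}) (T1 : {RV P >-> R}).
Hypothesis hind : independent_of_process V T1.
Local Notation mean := (marginal_mean P V).

Let nonneg := T1 @^-1` `[0, +oo[.
Let cell n k := T1 @^-1` `[k%:R / n.+1%:R, k.+1%:R / n.+1%:R[.

Lemma measurable_time_preimage (I : set R) :
  measurable I -> measurable (T1 @^-1` I).
Proof.
by move=> mI; rewrite -[X in measurable X]setTI; exact: measurable_funP.
Qed.

Lemma cell_up_grid n k w : cell n k w -> up_grid n (T1 w) = k.+1%:R / n.+1%:R.
Proof.
rewrite /cell/= in_itv/= => /andP[].
rewrite ler_pdivrMr// ltr_pdivlMr// => kT Tk.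
by rewrite /up_grid (@truncn_def _ _ k)// mulrC kT.
Qed.

Lemma bigcup_cell n : \bigcup_k cell n k = nonneg.
Proof.
apply/seteqP; split=> w.
  move=> [k _]; rewrite /cell /nonneg/= !in_itv/= andbT => /andP[+ _].
  exact/le_trans/divr_ge0.
rewrite /nonneg/= in_itv/= andbT => T0.
exists (Num.truncn (n.+1%:R * T1 w)) => //.
rewrite /cell/= in_itv/= ler_pdivrMr// ltr_pdivlMr// mulrC.
by apply: truncn_itv; rewrite mulr_ge0.
Qed.

Lemma trivIset_cell n : trivIset setT (cell n).
Proof.
move=> i j _ _ [w [/cell_up_grid + /cell_up_grid]] => -> /eqP.
by rewrite (inj_eq (mulIf _)) ?invr_eq0// eqr_nat eqSS => /eqP.
Qed.

Lemma measurable_cell n k : measurable (cell n k).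
Proof. exact: measurable_time_preimage. Qed.

Section fixed_function.
Variables (h : R -> R).
Hypotheses (mh : measurable_fun setT h) (h0 : forall x, 0 <= h x).

Let mhV s : measurable_fun setT (fun w => (h (V s w))%:E).
Proof. by apply/measurable_EFinP; exact: measurableT_comp. Qed.

Lemma measurable_grid_process n :
  measurable_fun nonneg (fun w => (h (V (up_grid n (T1 w)) w))%:E).
Proof.
rewrite -(bigcup_cell n); apply/measurable_fun_bigcup.
  exact: measurable_cell.
move=> k.
apply: (eq_measurable_fun (fun w => (h (V (k.+1%:R / n.+1%:R) w))%:E)).
  by move=> w; rewrite inE => /cell_up_grid ->.
exact: measurable_funTS.
Qed.

Lemma measurable_grid_mean n :
  measurable_fun nonneg (fun w => mean h (up_grid n (T1 w))).
Proof.
rewrite -(bigcup_cell n); apply/measurable_fun_bigcup.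
  exact: measurable_cell.
move=> k; apply: (eq_measurable_fun (fun=> mean h (k.+1%:R / n.+1%:R))).
  by move=> w; rewrite inE => /cell_up_grid ->.
exact: measurable_cst.
Qed.

Lemma integral_time_indep (I : set R) (s : R) : measurable I -> 0 <= s ->
  (\int[P]_(w in T1 @^-1` I) (h (V s w))%:E =
   \int[P]_(w in T1 @^-1` I) mean h s)%E.
Proof.
move=> mI s0.
have mTI := measurable_time_preimage I mI.
have mind : measurable_fun setT (fun x : R => (\1_I x)%:E : \bar R).
  by apply/measurable_EFinP; exact: measurable_indic.
rewrite integral_cst// integral_mkcond.
transitivity (\int[P]_w ((\1_I (T1 w))%:E * (h (V s w))%:E))%E.
  by apply: eq_integral => w _; rewrite epatch_indic muleC.
rewrite (ge0_integral_indep P T1 (V s) (fun x => (\1_I x)%:E)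
  (fun x => (h x)%:E))//.
- rewrite muleC; congr (_ * _)%E.
  by have := integral_indic P measurableT mTI; rewrite setIT => <-.
- move=> A B mA mB; apply: hind; first by exists A => //; rewrite setTI.
  apply: sub_sigma_algebra; exists s; first by rewrite /= in_itv/= s0.
  by exists B => //; rewrite setTI.
- exact/measurable_EFinP.
Qed.

(** On each cell the discretised time is constant, so that independence from one
marginal at a time suffices. *)
Lemma integral_grid n :
  (\int[P]_(w in nonneg) (h (V (up_grid n (T1 w)) w))%:E =
   \int[P]_(w in nonneg) mean h (up_grid n (T1 w)))%E.
Proof.
rewrite -(bigcup_cell n) !ge0_integral_bigcup//.
- apply: eq_eseriesr => k _.
  transitivity (\int[P]_(w in cell n k) (h (V (k.+1%:R / n.+1%:R) w))%:E)%E.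
    by apply: eq_integral => w; rewrite inE => /cell_up_grid ->.
  rewrite integral_time_indep// ?divr_ge0//.
  by apply: eq_integral => w; rewrite inE => /cell_up_grid ->.
- exact: measurable_cell.
- by rewrite bigcup_cell; exact: measurable_grid_mean.
- by move=> w _; exact: marginal_mean_ge0.
- exact: trivIset_cell.
- exact: measurable_cell.
- by rewrite bigcup_cell; exact: measurable_grid_process.
- by move=> w _; rewrite lee_fin.
- exact: trivIset_cell.
Qed.

End fixed_function.
End random_time.

(** * The process at an independent random time *)

(** The integrals below are restricted to the complement D of a null set N off
which the time is positive and the paths are right-continuous: on D the sampled
process is a pointwise limit of measurable functions, hence measurable. *)
Section conditioning.
Context {R : realType} {d : measure_display} {T : measurableType d}.
Variables (P : probability T R) (V : R -> {RV P >-> R}) (T1 : {RV P >-> R}).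
Hypotheses (hV : levy_process V) (hind : independent_of_process V T1).
Variable N : set T.
Hypotheses (mN : measurable N) (N0 : P N = 0%E).
Hypothesis T1_gt0 : forall w, ~ N w -> 0 < T1 w.
Hypothesis V_right : forall w, ~ N w -> forall t, 0 <= t ->
  V s w @[s --> t^'+] --> V t w.
Local Notation mean := (marginal_mean P V).
Let D := ~` N.

Let mD : measurable D. Proof. exact: measurableC. Qed.

Let nonneg := T1 @^-1` `[0, +oo[.

Let mnonneg : measurable nonneg.
Proof. exact: measurable_time_preimage. Qed.

Let subD : D `<=` nonneg.
Proof. by move=> w /T1_gt0/ltW; rewrite /nonneg/= in_itv/= andbT. Qed.

Let integral_D (f : T -> \bar R) : measurable_fun nonneg f ->
  (forall w, 0 <= f w)%E ->
  (\int[P]_(w in nonneg) f w = \int[P]_(w in D) f w)%E.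
Proof.
move=> mf f0; rewrite (ge0_negligible_integral mN)//.
by rewrite setDE setIidr.
Qed.

(** Dominated convergence, for h (V (T1 w) w) and for the mean of h at T1 w:
both are limits of their discretised versions, whose integrals agree. *)
Lemma integral_at_time_bounded (h : R -> R) (M : R) : continuous h ->
  (forall x, 0 <= h x <= M) ->
  [/\ measurable_fun D (fun w => (h (V (T1 w) w))%:E),
      measurable_fun D (fun w => mean h (T1 w)) &
      (\int[P]_(w in D) (h (V (T1 w) w))%:E =
       \int[P]_(w in D) mean h (T1 w))%E].
Proof.
move=> ch hM.
have h0 x : 0 <= h x by case/andP: (hM x).
have mh : measurable_fun setT h by exact: continuous_measurable_fun.
have mf n : measurable_fun D (fun w => (h (V (up_grid n (T1 w)) w))%:E).
  apply: (measurable_funS mnonneg subD).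
  exact: (measurable_grid_process P V T1 h mh n).
have mg n : measurable_fun D (fun w => mean h (up_grid n (T1 w))).
  apply: (measurable_funS mnonneg subD).
  exact: (measurable_grid_mean P V T1 h n).
have cf w : D w -> (h (V (up_grid n (T1 w)) w))%:E @[n --> \oo] -->
    (h (V (T1 w) w))%:E.
  move=> Dw.
  have hcvg : h (V (up_grid n (T1 w)) w) @[n --> \oo] --> h (V (T1 w) w).
    apply: (@continuous_cvg _ _ _ _ _ (fun n => V (up_grid n (T1 w)) w) h).
      exact: ch.
    apply: (cvg_right_up_grid (fun s => V s w)); first exact/ltW/T1_gt0.
    by apply: V_right => //; exact/ltW/T1_gt0.
  by apply: cvg_EFin hcvg; exact: nearW.
have cg w : D w -> mean h (up_grid n (T1 w)) @[n --> \oo] --> mean h (T1 w).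
  move=> Dw; apply: (marginal_mean_right_cvg _ _ hV _ _ M) => //.
  exact/ltW/T1_gt0.
have mf' := emeasurable_fun_cvg _ _ mf cf.
have mg' := emeasurable_fun_cvg _ _ mg cg.
have icst : P.-integrable D (cst M%:E) by exact: finite_measure_integrable_cst.
split => //.
have [] := dominated_convergence mD mf mf' (aeW _ cf) icst.
  apply: aeW => w n _; rewrite /= lee_fin ger0_norm//.
  by case/andP: (hM (V (up_grid n (T1 w)) w)).
move=> _ _ cIf.
have [] := dominated_convergence mD mg mg' (aeW _ cg) icst.
  apply: aeW => w n _ /=; rewrite gee0_abs ?marginal_mean_ge0//.
  exact: marginal_mean_le.
move=> _ _ cIg.
rewrite -(cvg_lim _ cIf)// -(cvg_lim _ cIg)//; congr (limn _).
apply/funext => n /=.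
rewrite -(integral_D _ (measurable_grid_process P V T1 h mh n)); last first.
  by move=> w; rewrite lee_fin.
rewrite -(integral_D _ (measurable_grid_mean P V T1 h n)); last first.
  by move=> w; exact: marginal_mean_ge0.
exact: integral_grid.
Qed.

(** Truncation of h at m and monotone convergence on both sides. *)
Lemma integral_at_time (h : R -> R) : continuous h -> (forall x, 0 <= h x) ->
  [/\ measurable_fun D (fun w => (h (V (T1 w) w))%:E),
      measurable_fun D (fun w => mean h (T1 w)) &
      (\int[P]_(w in D) (h (V (T1 w) w))%:E =
       \int[P]_(w in D) mean h (T1 w))%E].
Proof.
move=> ch h0.
have mh : measurable_fun setT h by exact: continuous_measurable_fun.
pose hm m x := Num.min (h x) m%:R.
have hm0 m x : 0 <= hm m x by rewrite le_min h0/=.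
have mhm m : measurable_fun setT (hm m) by exact: measurable_minr.
have hmS x m n : (m <= n)%N -> hm m x <= hm n x.
  by move=> mn; rewrite le_min2// ler_nat.
have H m : [/\ measurable_fun D (fun w => (hm m (V (T1 w) w))%:E),
      measurable_fun D (fun w => mean (hm m) (T1 w)) &
      (\int[P]_(w in D) (hm m (V (T1 w) w))%:E =
       \int[P]_(w in D) mean (hm m) (T1 w))%E].
  apply: (integral_at_time_bounded _ m%:R); first exact: continuous_min_natr.
  by move=> x; rewrite hm0 ge_min lexx orbT.
have cf w : D w -> (hm n (V (T1 w) w))%:E @[n --> \oo] --> (h (V (T1 w) w))%:E.
  by move=> _; exact: cvg_min_natr.
have cg w : D w -> mean (hm n) (T1 w) @[n --> \oo] --> mean h (T1 w).
  by move=> _; exact: cvg_marginal_mean_min.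
have mf m : measurable_fun D (fun w => (hm m (V (T1 w) w))%:E) by case: (H m).
have mg m : measurable_fun D (fun w => mean (hm m) (T1 w)) by case: (H m).
split; [exact: emeasurable_fun_cvg cf|exact: emeasurable_fun_cvg cg|].
have /cvg_lim <-// :
  (\int[P]_(w in D) (hm n (V (T1 w) w))%:E)%E @[n --> \oo] -->
    (\int[P]_(w in D) (h (V (T1 w) w))%:E)%E.
  apply: cvg_integral_nondecreasing cf => //.
    by move=> n w _; rewrite lee_fin.
  by move=> w _ m n mn; rewrite lee_fin hmS.
have /cvg_lim <-// : (\int[P]_(w in D) mean (hm n) (T1 w))%E @[n --> \oo] -->
    (\int[P]_(w in D) mean h (T1 w))%E.
  apply: cvg_integral_nondecreasing cg => //.
    by move=> n w _; exact: marginal_mean_ge0.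
  move=> w _ m n mn; apply: ge0_le_integral => //.
  - by move=> x _; rewrite lee_fin.
  - by apply/measurable_EFinP; exact: measurableT_comp.
  - by apply/measurable_EFinP; exact: measurableT_comp.
  - by move=> x _; rewrite lee_fin hmS.
by congr (limn _); apply/funext => n; case: (H n).
Qed.

End conditioning.

(** * The theorem *)

Theorem mainTheorem2 (R : realType) (d : measure_display)
    (T : measurableType d) (P : probability T R)
    (V : R -> {RV P >-> R}) (T1 : {RV P >-> R})
    (hV : levy_process V)
    (hT1 : {ae P, forall w, 0 < T1 w})
    (hind : independent_of_process V T1) :
  let psi_V := laplace_exponent P (V 1) in
  let H := laplace_exponent P (process_at V T1) in
  (forall beta : R, 0 < beta ->
    [/\ ('E_P[fun w => expR (- beta * process_at V T1 w)]
           = \int[P]_w expeR ((T1 w)%:E * psi_V beta))%E,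
        H beta = 0%E <-> (\int[P]_w expeR ((T1 w)%:E * psi_V beta))%E = 1%E &
        (\int[P]_w expeR ((T1 w)%:E * psi_V beta))%E = 1%E <->
          psi_V beta = 0%E]) /\
  (forall beta : R,
    unique (fun q : R => 0 < q /\ H q = 0%E) beta ->
    interior (dom H) beta ->
    psi_V beta = 0%E).
Proof.
move=> psi_V H.
suff main beta : [/\ ('E_P[fun w => expR (- beta * process_at V T1 w)]
           = \int[P]_w expeR ((T1 w)%:E * psi_V beta))%E,
        H beta = 0%E <-> (\int[P]_w expeR ((T1 w)%:E * psi_V beta))%E = 1%E &
        (\int[P]_w expeR ((T1 w)%:E * psi_V beta))%E = 1%E <->
          psi_V beta = 0%E].
  split=> [beta _|beta [[_ Hbeta] _] _]; first exact: main.
  by have [_ h1 h2] := main beta; apply/h2/h1.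
have [N [mN N0 subN]] := filterI hT1 (levy_cadlag hV).
have good w : ~ N w -> 0 < T1 w /\
    forall t, 0 <= t -> V s w @[s --> t^'+] --> V t w.
  move=> Nw; apply: contrapT => bad; apply: Nw; apply: subN => /= -[T0 [rc _]].
  exact: bad.
pose D := ~` N.
have mD : measurable D by exact: measurableC.
have PD : P D = 1%E by rewrite probability_setC// N0 sube0.
pose h x := expR (- beta * x).
have ch : continuous h.
  move=> x; apply: continuous_comp; last exact: continuous_expR.
  by apply: cvgMr; exact: cvg_id.
have psiE : psi_V beta = lne (marginal_mean P V h 1).
  by rewrite /psi_V /laplace_exponent unlock.
pose F w := expeR ((T1 w)%:E * psi_V beta).
have F0 w : (0 <= F w)%E by exact: expeR_ge0.
have FE w : D w -> marginal_mean P V h (T1 w) = F w.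
  by move=> /good[T0 _]; rewrite /F psiE; exact: marginal_mean_exp.
have [_ mmean Eh] := integral_at_time P V T1 hV hind N mN N0
  (fun w Nw => (good w Nw).1) (fun w Nw => (good w Nw).2) h ch
  (fun x => expR_ge0 _).
have mF : measurable_fun D F.
  by apply: eq_measurable_fun mmean => w /[!inE] /FE.
have IF : (\int[P]_w F w = \int[P]_(w in D) F w)%E by exact: integral_ge0_null.
have EF : ('E_P[fun w => expR (- beta * process_at V T1 w)] = \int[P]_w F w)%E.
  rewrite unlock (integral_ge0_null _ N)//.
  by rewrite IF [LHS]Eh; apply: eq_integral => w /[!inE] /FE.
have I1 : (\int[P]_(w in D) cst 1 w = 1 :> \bar R)%E.
  by rewrite integral_cst// mul1e.
split => //.
  by rewrite /H /laplace_exponent EF; split=> /eqP; [rewrite lne_eq0|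
    rewrite -lne_eq0] => /eqP.
split=> [|psi0]; last first.
  rewrite (eq_integral (cst 1%E)) => [|w _]; last by rewrite psi0 mule0 expeR0.
  rewrite integral_cst// mul1e; exact: probability_setT.
rewrite -/F IF => F1.
have PD0 : P D != 0%E by rewrite PD onee_neq0.
(* F is pointwise on the same strict side of 1 as psi_V beta is of 0. *)
have [psi_lt0|psi_gt0|//] := ltgtP (psi_V beta) 0%E.
- have : (\int[P]_(w in D) F w < \int[P]_(w in D) cst 1 w)%E.
    apply: integral_lt => //; last by rewrite F1 ltry.
    move=> w /good[T0 _]; rewrite /F/= -[ltRHS]expeR0 lte_expeR.
    by rewrite mule_gt0_lt0// lte_fin.
  by rewrite F1 I1 ltxx.
- have : (\int[P]_(w in D) cst 1 w < \int[P]_(w in D) F w)%E.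
    apply: integral_lt => //; last by rewrite I1 ltry.
    move=> w /good[T0 _]; rewrite /F/= -[ltLHS]expeR0 lte_expeR.
    by rewrite mule_gt0// lte_fin.
  by rewrite F1 I1 ltxx.
Qed.
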